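(* Let $(\mathcal{T},\otimes,\Sigma,\mathbb{1})$ be a non-zero monoidal triangulated category and let $\mathbb{t}=(\mathcal{D}^{\leqslant 0},\mathcal{D}^{\geqslant 1})$ be a tensor reduced monoidal t-structure on $\mathcal{T}$. (1) If $\mathcal{T}$ has left duals, then $(\mathcal{D}^{\leqslant 0})^{\ast}\subseteq\mathcal{D}^{\geqslant 0}$ and $(\mathcal{D}^{\geqslant 0})^{\ast}\subseteq\mathcal{D}^{\leqslant 0}$, which implies that $\mathcal{H}_{\mathbb{t}}$ has left duals. (2) If $\mathcal{T}$ has right duals, then ${}^{\ast}(\mathcal{D}^{\leqslant 0})\subseteq\mathcal{D}^{\geqslant 0}$ and ${}^{\ast}(\mathcal{D}^{\geqslant 0})\subseteq\mathcal{D}^{\leqslant 0}$, which implies that $\mathcal{H}_{\mathbb{t}}$ has right duals. As a consequence, if $\mathcal{T}$ is rigid and $\mathrm{End}_{\mathcal{T}}(\mathbb{1})\cong\mathbb{k}$, then $\mathcal{H}_{\mathbb{t}}$ is a tensor category.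
   Context: All categories are linear over an algebraically closed field $\mathbb{k}$. A monoidal triangulated category $(\mathcal{T},\otimes,\Sigma,\mathbb{1})$ is a triangulated category with shift $\Sigma$ that is also monoidal with unit $\mathbb{1}$ such that $\otimes$ is exact (triangulated) in each variable (and $\mathbb{k}$-bilinear on morphisms); this involves isomorphisms $\Sigma(X)\otimes Y\cong\Sigma(X\otimes Y)\cong X\otimes\Sigma(Y)$ natural in $X,Y$ (no further compatibility is required). In a monoidal category a left dual of $X$ is an object $X^\ast$ with morphisms $\mathrm{ev}_X:X^\ast\otimes X\to\mathbb{1}$ and $\mathrm{coev}_X:\mathbb{1}\to X\otimes X^\ast$ such that the compositions $X\to X\otimes X^\ast\otimes X\to X$ and $X^\ast\to X^\ast\otimes X\otimes X^\ast\to X^\ast$ they induce are identities; a right dual ${}^\ast X$ is defined dually. The category has left (right) duals if every object has one, and is rigid if it has both. For a subcategory $\mathcal{D}$, $\mathcal{D}^\ast$ (resp. ${}^\ast\mathcal{D}$) denotes the class of left (resp. right) duals of its objects. A tensor category is a rigid monoidal abelian category whose tensor product is bilinear on morphisms and with $\mathrm{End}(\mathbb{1})\cong\mathbb{k}$. A t-structure on $\mathcal{T}$ is a pair of full strict subcategories $\mathbb{t}=(\mathcal{D}^{\leqslant 0},\mathcal{D}^{\geqslant 1})$ with $\Sigma\mathcal{D}^{\leqslant 0}\subseteq\mathcal{D}^{\leqslant 0}$, $\mathcal{D}^{\geqslant 1}\subseteq\Sigma\mathcal{D}^{\geqslant 1}$, $\mathrm{Hom}_{\mathcal{T}}(\mathcal{D}^{\leqslant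 0},\mathcal{D}^{\geqslant 1})=0$, and for each $X\in\mathcal{T}$ a distinguished triangle $X^{\leqslant 0}\to X\to X^{\geqslant 1}\to\Sigma X^{\leqslant 0}$ with $X^{\leqslant 0}\in\mathcal{D}^{\leqslant 0}$, $X^{\geqslant 1}\in\mathcal{D}^{\geqslant 1}$. Put $\mathcal{D}^{\leqslant n}:=\Sigma^{-n}\mathcal{D}^{\leqslant 0}$, $\mathcal{D}^{\geqslant n+1}:=\Sigma^{-n}\mathcal{D}^{\geqslant 1}$; the heart is the abelian category $\mathcal{H}_{\mathbb{t}}:=\mathcal{D}^{\leqslant 0}\cap\mathcal{D}^{\geqslant 0}$. $\mathbb{t}$ is bounded if $\bigcup_n\mathcal{D}^{\leqslant n}=\mathcal{T}=\bigcup_n\mathcal{D}^{\geqslant n}$. A monoidal t-structure is a bounded t-structure for which there exists $n\in\mathbb{Z}$ with $\mathcal{D}^{\leqslant 0}\otimes\mathcal{D}^{\leqslant n}\subseteq\mathcal{D}^{\leqslant 0}$ and $\mathcal{D}^{\geqslant 0}\otimes\mathcal{D}^{\geqslant n}\subseteq\mathcal{D}^{\geqslant 0}$; the set of all such $n$ is the deviation $\mathrm{dev}(\mathbb{t})$. If $0\in\mathrm{dev}(\mathbb{t})$, then $\mathcal{H}_{\mathbb{t}}$ is a monoidal abelian category under the tensor product of $\mathcal{T}$, with unit $H^0_{\mathbb{t}}(\mathbb{1})$, where $H^0_{\mathbb{t}}=\tau^{\leqslant 0}_{\mathbb{t}}\tau^{\geqslant 0}_{\mathbb{t}}$ is the cohomological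 functor of $\mathbb{t}$. A monoidal additive category is tensor reduced if for every object $X$, $X\otimes X=0$ if and only if $X=0$. A tensor reduced monoidal t-structure is a monoidal t-structure $\mathbb{t}$ with $0\in\mathrm{dev}(\mathbb{t})$ whose heart is tensor reduced. *)

(* Defs.v *)
From HB Require Import structures.
From mathcomp Require Import all_boot all_algebra.
From Stdlib Require Import ClassicalEpsilon.

Set Implicit Arguments.
Unset Strict Implicit.
Unset Printing Implicit Defensive.

Import GRing.Theory.
Local Open Scope ring_scope.

Record linCat (k : fieldType) := LinCat {
  ob :> Type;
  hom : ob -> ob -> lmodType k;
  idm : forall X, hom X X;
  compm : forall X Y Z, hom Y Z -> hom X Y -> hom X Z;
  compmA : forall X Y Z W (h : hom Z W) (g : hom Y Z) (f : hom X Y),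
    compm h (compm g f) = compm (compm h g) f;
  comp1m : forall X Y (f : hom X Y), compm (idm Y) f = f;
  compm1 : forall X Y (f : hom X Y), compm f (idm X) = f;
  compm_linl : forall X Y Z (f : hom X Y), linear (fun g : hom Y Z => compm g f);
  compm_linr : forall X Y Z (g : hom Y Z), linear (fun f : hom X Y => compm g f)
}.

Arguments hom {k l} _ _.
Arguments idm {k l} X.
Arguments compm {k l X Y Z} _ _.

Declare Scope lincat_scope.
Delimit Scope lincat_scope with lincat.
Open Scope lincat_scope.
Notation "g ∘ f" := (compm g f) (at level 40, left associativity) : lincat_scope.

Section LinCat.
Variables (k : fieldType) (C : linCat k).

Definition is_iso (X Y : C) (f : hom X Y) : Prop :=
  exists g : hom Y X, g ∘ f = idm X /\ f ∘ g = idm Y.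

Definition iso_inv (X Y : C) (f : hom X Y) (isof : is_iso f) : hom Y X :=
  proj1_sig (constructive_indefinite_description _ isof).

Definition isomorphic (X Y : C) : Prop := exists f : hom X Y, is_iso f.

Definition is_zero (X : C) : Prop :=
  forall Y : C, (forall f : hom X Y, f = 0) /\ (forall f : hom Y X, f = 0).

Definition nonzero_cat : Prop := exists X : C, ~ is_zero X.

Definition is_biproduct (X Y S : C) : Prop :=
  exists (i1 : hom X S) (i2 : hom Y S) (p1 : hom S X) (p2 : hom S Y),
    [/\ p1 ∘ i1 = idm X, p2 ∘ i2 = idm Y, p1 ∘ i2 = 0, p2 ∘ i1 = 0
      & i1 ∘ p1 + i2 ∘ p2 = idm S].

Definition additive_cat : Prop :=
  (exists Z : C, is_zero Z) /\ (forall X Y : C, exists S, is_biproduct X Y S).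

Definition mono (X Y : C) (f : hom X Y) : Prop :=
  forall W (u v : hom W X), f ∘ u = f ∘ v -> u = v.

Definition epi (X Y : C) (f : hom X Y) : Prop :=
  forall W (u v : hom Y W), u ∘ f = v ∘ f -> u = v.

Definition is_kernel (K X Y : C) (i : hom K X) (f : hom X Y) : Prop :=
  f ∘ i = 0 /\
  forall W (u : hom W X), f ∘ u = 0 -> exists! v : hom W K, i ∘ v = u.

Definition is_cokernel (X Y Q : C) (p : hom Y Q) (f : hom X Y) : Prop :=
  p ∘ f = 0 /\
  forall W (u : hom Y W), u ∘ f = 0 -> exists! v : hom Q W, v ∘ p = u.

Definition abelian_cat : Prop :=
  [/\ additive_cat,
      forall (X Y : C) (f : hom X Y), exists K (i : hom K X), is_kernel i f,
      forall (X Y : C) (f : hom X Y), exists Q (p : hom Y Q), is_cokernel p f,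
      forall (X Y : C) (f : hom X Y), mono f ->
        exists Z (g : hom Y Z), is_kernel f g
    & forall (X Y : C) (f : hom X Y), epi f ->
        exists Z (g : hom Z X), is_cokernel f g].

(* An isomorphism of k-algebras between k and End(X). *)
Definition End_iso_base (X : C) : Prop :=
  exists phi : k^o -> hom X X,
    [/\ bijective phi, linear phi, phi 1 = idm X
      & forall a b : k, phi (a * b) = phi a ∘ phi b].

Definition full_sub (P : C -> Prop) : linCat k :=
  @LinCat k {X : C | P X} (fun X Y => hom (sval X) (sval Y))
    (fun X => idm (sval X)) (fun _ _ _ g f => g ∘ f)
    (fun _ _ _ _ h g f => compmA h g f) (fun _ _ f => comp1m f)
    (fun _ _ f => compm1 f) (fun _ _ _ f => @compm_linl _ _ _ _ _ f)
    (fun _ _ _ g => @compm_linr _ _ _ _ _ g).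

End LinCat.

Record linFunctor (k : fieldType) (C D : linCat k) := LinFunctor {
  fob :> C -> D;
  fmap : forall X Y, hom X Y -> hom (fob X) (fob Y);
  fmap1 : forall X, fmap (idm X) = idm (fob X);
  fmapM : forall X Y Z (g : hom Y Z) (f : hom X Y),
    fmap (g ∘ f) = fmap g ∘ fmap f;
  fmap_lin : forall X Y, linear (@fmap X Y)
}.

Record monoidal (k : fieldType) (C : linCat k) := Monoidal {
  tens : C -> C -> C;
  tensm : forall X X' Y Y',
    hom X X' -> hom Y Y' -> hom (tens X Y) (tens X' Y');
  munit : C;
  assoc : forall X Y Z, hom (tens (tens X Y) Z) (tens X (tens Y Z));
  assocV : forall X Y Z, hom (tens X (tens Y Z)) (tens (tens X Y) Z);
  lunit : forall X, hom (tens munit X) X;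
  lunitV : forall X, hom X (tens munit X);
  runit : forall X, hom (tens X munit) X;
  runitV : forall X, hom X (tens X munit);
  tensm1 : forall X Y, tensm (idm X) (idm Y) = idm (tens X Y);
  tensmM : forall X X' X'' Y Y' Y'' (f' : hom X' X'') (f : hom X X')
      (g' : hom Y' Y'') (g : hom Y Y'),
    tensm (f' ∘ f) (g' ∘ g) = tensm f' g' ∘ tensm f g;
  assocK : forall X Y Z, assocV X Y Z ∘ assoc X Y Z = idm _;
  assocVK : forall X Y Z, assoc X Y Z ∘ assocV X Y Z = idm _;
  lunitK : forall X, lunitV X ∘ lunit X = idm _;
  lunitVK : forall X, lunit X ∘ lunitV X = idm _;
  runitK : forall X, runitV X ∘ runit X = idm _;
  runitVK : forall X, runit X ∘ runitV X = idm _;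
  assoc_nat : forall X X' Y Y' Z Z' (f : hom X X') (g : hom Y Y') (h : hom Z Z'),
    assoc X' Y' Z' ∘ tensm (tensm f g) h = tensm f (tensm g h) ∘ assoc X Y Z;
  lunit_nat : forall X X' (f : hom X X'),
    lunit X' ∘ tensm (idm munit) f = f ∘ lunit X;
  runit_nat : forall X X' (f : hom X X'),
    runit X' ∘ tensm f (idm munit) = f ∘ runit X;
  pentagon : forall X Y Z W,
    assoc X Y (tens Z W) ∘ assoc (tens X Y) Z W =
    tensm (idm X) (assoc Y Z W) ∘ assoc X (tens Y Z) W
      ∘ tensm (assoc X Y Z) (idm W);
  triangle : forall X Y,
    tensm (idm X) (lunit Y) ∘ assoc X munit Y = tensm (runit X) (idm Y)
}.

Arguments munit {k C} m.
Arguments assoc {k C m} X Y Z.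
Arguments assocV {k C m} X Y Z.
Arguments lunit {k C m} X.
Arguments lunitV {k C m} X.
Arguments runit {k C m} X.
Arguments runitV {k C m} X.

Notation "X ⊗[ M ] Y" := (tens M X Y)
  (at level 35, right associativity, format "X  ⊗[ M ]  Y") : lincat_scope.
Notation "f ⊠[ M ] g" := (tensm M f g)
  (at level 35, right associativity, format "f  ⊠[ M ]  g") : lincat_scope.

Section Monoidal.
Variables (k : fieldType) (C : linCat k) (M : monoidal C).

Definition tens_bilinear : Prop :=
  (forall (X X' Y Y' : C) (g : hom Y Y'),
     linear (fun f : hom X X' => f ⊠[M] g)) /\
  (forall (X X' Y Y' : C) (f : hom X X'),
     linear (fun g : hom Y Y' => f ⊠[M] g)).

Definition zigzag (X Y : C) (ev : hom (Y ⊗[M] X) (munit M))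
    (coev : hom (munit M) (X ⊗[M] Y)) : Prop :=
  runit X ∘ (idm X ⊠[M] ev) ∘ assoc X Y X ∘ (coev ⊠[M] idm X) ∘ lunitV X = idm X
  /\
  lunit Y ∘ (ev ⊠[M] idm Y) ∘ assocV Y X Y ∘ (idm Y ⊠[M] coev) ∘ runitV Y = idm Y.

Definition left_dual (X Y : C) : Prop :=
  exists (ev : hom (Y ⊗[M] X) (munit M)) (coev : hom (munit M) (X ⊗[M] Y)),
    zigzag ev coev.

Definition right_dual (X Y : C) : Prop :=
  exists (ev : hom (X ⊗[M] Y) (munit M)) (coev : hom (munit M) (Y ⊗[M] X)),
    zigzag ev coev.

Definition left_duals_of (P : C -> Prop) (Y : C) : Prop :=
  exists2 X, P X & left_dual X Y.

Definition right_duals_of (P : C -> Prop) (Y : C) : Prop :=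
  exists2 X, P X & right_dual X Y.

Definition has_left_duals : Prop := forall X : C, exists Y, left_dual X Y.

Definition has_right_duals : Prop := forall X : C, exists Y, right_dual X Y.

Definition rigid : Prop := has_left_duals /\ has_right_duals.

Definition tensor_category : Prop :=
  [/\ abelian_cat C, rigid, tens_bilinear & End_iso_base (munit M)].

Definition tensor_reduced : Prop :=
  forall X : C, is_zero (X ⊗[M] X) <-> is_zero X.

End Monoidal.

Record triCat (k : fieldType) := TriCat {
  tri_cat :> linCat k;
  tri_add : additive_cat tri_cat;
  shift : linFunctor tri_cat tri_cat;
  unshift : linFunctor tri_cat tri_cat;
  shiftK : forall X, hom (unshift (shift X)) X;
  shiftK_iso : forall X, is_iso (shiftK X);
  shiftK_nat : forall X Y (f : hom X Y),
    shiftK Y ∘ fmap unshift (fmap shift f) = f ∘ shiftK X;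
  unshiftK : forall X, hom (shift (unshift X)) X;
  unshiftK_iso : forall X, is_iso (unshiftK X);
  unshiftK_nat : forall X Y (f : hom X Y),
    unshiftK Y ∘ fmap shift (fmap unshift f) = f ∘ unshiftK X;
  dist : forall X Y Z, hom X Y -> hom Y Z -> hom Z (shift X) -> Prop;
  dist_iso : forall X Y Z X' Y' Z'
      (f : hom X Y) (g : hom Y Z) (h : hom Z (shift X))
      (f' : hom X' Y') (g' : hom Y' Z') (h' : hom Z' (shift X'))
      (a : hom X X') (b : hom Y Y') (c : hom Z Z'),
    is_iso a -> is_iso b -> is_iso c ->
    b ∘ f = f' ∘ a -> c ∘ g = g' ∘ b -> fmap shift a ∘ h = h' ∘ c ->
    dist f g h -> dist f' g' h';
  dist_id : forall X Z, is_zero Z ->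
    dist (idm X) (0 : hom X Z) (0 : hom Z (shift X));
  dist_cone : forall X Y (f : hom X Y),
    exists Z (g : hom Y Z) (h : hom Z (shift X)), dist f g h;
  dist_rot : forall X Y Z (f : hom X Y) (g : hom Y Z) (h : hom Z (shift X)),
    dist f g h <-> dist g h (- fmap shift f);
  dist_mor : forall X Y Z X' Y' Z'
      (f : hom X Y) (g : hom Y Z) (h : hom Z (shift X))
      (f' : hom X' Y') (g' : hom Y' Z') (h' : hom Z' (shift X'))
      (a : hom X X') (b : hom Y Y'),
    dist f g h -> dist f' g' h' -> b ∘ f = f' ∘ a ->
    exists c : hom Z Z', c ∘ g = g' ∘ b /\ fmap shift a ∘ h = h' ∘ c;
  dist_octahedron : forall X Y Z Z' X' Y' (f : hom X Y) (g : hom Y Z)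
      (i : hom Y Z') (i' : hom Z' (shift X))
      (j : hom Z X') (j' : hom X' (shift Y))
      (l : hom Z Y') (l' : hom Y' (shift X)),
    dist f i i' -> dist g j j' -> dist (g ∘ f) l l' ->
    exists (u : hom Z' Y') (v : hom Y' X'),
      [/\ dist u v (fmap shift i ∘ j'),
          u ∘ i = l ∘ g, l' ∘ u = i', v ∘ l = j & j' ∘ v = fmap shift f ∘ l']
}.

Arguments shift {k} t.
Arguments unshift {k} t.
Arguments dist {k t X Y Z} _ _ _.

Definition shiftz (k : fieldType) (T : triCat k) (n : int) (X : T) : T :=
  match n with
  | Posz m => iter m (shift T) X
  | Negz m => iter m.+1 (unshift T) X
  end.

Record monTriCat (k : fieldType) := MonTriCat {
  mt_tri :> triCat k;
  mt_mon :> monoidal mt_tri;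
  mt_bilinear : tens_bilinear mt_mon;
  shiftl : forall X Y : mt_tri,
    hom (shift mt_tri X ⊗[mt_mon] Y) (shift mt_tri (X ⊗[mt_mon] Y));
  shiftl_iso : forall X Y, is_iso (shiftl X Y);
  shiftl_nat : forall X X' Y Y' (f : hom X X') (g : hom Y Y'),
    shiftl X' Y' ∘ (fmap (shift mt_tri) f ⊠[mt_mon] g) =
    fmap (shift mt_tri) (f ⊠[mt_mon] g) ∘ shiftl X Y;
  shiftr : forall X Y : mt_tri,
    hom (X ⊗[mt_mon] shift mt_tri Y) (shift mt_tri (X ⊗[mt_mon] Y));
  shiftr_iso : forall X Y, is_iso (shiftr X Y);
  shiftr_nat : forall X X' Y Y' (f : hom X X') (g : hom Y Y'),
    shiftr X' Y' ∘ (f ⊠[mt_mon] fmap (shift mt_tri) g) =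
    fmap (shift mt_tri) (f ⊠[mt_mon] g) ∘ shiftr X Y;
  tens_exactl : forall X Y Z (f : hom X Y) (g : hom Y Z)
      (h : hom Z (shift mt_tri X)) W,
    dist f g h ->
    dist (f ⊠[mt_mon] idm W) (g ⊠[mt_mon] idm W)
         (shiftl X W ∘ (h ⊠[mt_mon] idm W));
  tens_exactr : forall X Y Z (f : hom X Y) (g : hom Y Z)
      (h : hom Z (shift mt_tri X)) W,
    dist f g h ->
    dist (idm W ⊠[mt_mon] f) (idm W ⊠[mt_mon] g)
         (shiftr W X ∘ (idm W ⊠[mt_mon] h))
}.

(* A full strict subcategory is given by an isomorphism-invariant predicate on
   objects: tle0 is D^{<=0}, tge1 is D^{>=1}. *)
Record tstructure (k : fieldType) (T : triCat k) := TStructure {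
  tle0 : T -> Prop;
  tge1 : T -> Prop;
  tle0_strict : forall X Y, isomorphic X Y -> tle0 X -> tle0 Y;
  tge1_strict : forall X Y, isomorphic X Y -> tge1 X -> tge1 Y;
  tle0_shift : forall X, tle0 X -> tle0 (shift T X);
  tge1_shift : forall X, tge1 X -> exists2 Y, tge1 Y & isomorphic X (shift T Y);
  tle0_tge1 : forall X Y, tle0 X -> tge1 Y -> forall f : hom X Y, f = 0;
  t_triangle : forall X, exists A B (f : hom A X) (g : hom X B)
      (h : hom B (shift T A)), [/\ tle0 A, tge1 B & dist f g h]
}.

Section TStructure.
Variables (k : fieldType) (T : triCat k) (t : tstructure T).

Definition Dle (n : int) (X : T) : Prop :=
  exists2 Y, tle0 t Y & isomorphic X (shiftz (- n) Y).

Definition Dge (n : int) (X : T) : Prop :=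
  exists2 Y, tge1 t Y & isomorphic X (shiftz (- (n - 1)) Y).

Definition t_bounded : Prop :=
  (forall X, exists n, Dle n X) /\ (forall X, exists n, Dge n X).

Definition in_heart (X : T) : Prop := Dle 0 X /\ Dge 0 X.

Definition heart : linCat k := full_sub in_heart.

Record trunc_triangle (X : T) := TruncTriangle {
  tau_le0 : T;
  tau_ge1 : T;
  tau_le0_to : hom tau_le0 X;
  to_tau_ge1 : hom X tau_ge1;
  tau_bd : hom tau_ge1 (shift T tau_le0);
  tau_le0P : tle0 t tau_le0;
  tau_ge1P : tge1 t tau_ge1;
  tau_dist : dist tau_le0_to to_tau_ge1 tau_bd
}.

Lemma trunc_exists (X : T) : exists _ : trunc_triangle X, True.
Proof.
have [A [B [f [g [h [A0 B0 d]]]]]] := t_triangle t X.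
by exists (TruncTriangle A0 B0 d).
Qed.

Definition trunc (X : T) : trunc_triangle X :=
  proj1_sig (constructive_indefinite_description _ (trunc_exists X)).

(* The truncation triangle for (D^{<=-1}, D^{>=0}) of X is the shift of the one
   for (D^{<=0}, D^{>=1}) of the desuspension of X. *)
Definition tau_ge0 (X : T) : T := shift T (tau_ge1 (trunc (unshift T X))).

Definition to_tau_ge0 (X : T) : hom X (tau_ge0 X) :=
  fmap (shift T) (to_tau_ge1 (trunc (unshift T X))) ∘ iso_inv (unshiftK_iso X).

Definition H0 (X : T) : T := tau_le0 (trunc (tau_ge0 X)).

End TStructure.

Section MonTStructure.
Variables (k : fieldType) (T : monTriCat k) (t : tstructure T).

Definition dev (n : int) : Prop :=
  (forall X Y, Dle t 0 X -> Dle t n Y -> Dle t 0 (X ⊗[T] Y)) /\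
  (forall X Y, Dge t 0 X -> Dge t n Y -> Dge t 0 (X ⊗[T] Y)).

Definition monoidal_tstructure : Prop := t_bounded t /\ exists n, dev n.

End MonTStructure.

Section LinCatTheory.
Variables (k : fieldType) (C : linCat k).

Lemma linear_fun0 (U V : lmodType k) (phi : U -> V) : linear phi -> phi 0 = 0.
Proof. by move=> H; have := H (-1) 0 0; rewrite scaler0 addr0 scaleN1r addNr. Qed.

Lemma linear_funN (U V : lmodType k) (phi : U -> V) :
  linear phi -> forall u, phi (- u) = - phi u.
Proof.
move=> H u; have := H (-1) u 0; rewrite !scaleN1r addr0 => ->.
by rewrite (linear_fun0 H) addr0.
Qed.

Lemma comp0m (X Y Z : C) (f : hom X Y) : (0 : hom Y Z) ∘ f = 0.
Proof. exact: (linear_fun0 (compm_linl f)). Qed.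

Lemma compm0 (X Y Z : C) (g : hom Y Z) : g ∘ (0 : hom X Y) = 0.
Proof. exact: (linear_fun0 (compm_linr g)). Qed.

Lemma compNm (X Y Z : C) (g : hom Y Z) (f : hom X Y) : (- g) ∘ f = - (g ∘ f).
Proof. exact: (linear_funN (compm_linl f)). Qed.

Lemma compmN (X Y Z : C) (g : hom Y Z) (f : hom X Y) : g ∘ (- f) = - (g ∘ f).
Proof. exact: (linear_funN (compm_linr g)). Qed.

Lemma compmB (X Y Z : C) (g : hom Y Z) (u v : hom X Y) :
  g ∘ (u - v) = g ∘ u - g ∘ v.
Proof.
by have := compm_linr g (-1) v u; rewrite /= !scaleN1r ![- _ + _]addrC.
Qed.

Lemma fmap0 (D : linCat k) (F : linFunctor C D) (X Y : C) :
  fmap F (0 : hom X Y) = 0.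
Proof. exact: (linear_fun0 (@fmap_lin _ _ _ F X Y)). Qed.

Lemma is_zeroP (X : C) : is_zero X <-> idm X = 0.
Proof.
split=> [H|H Y]; first by case: (H X).
by split=> f; [rewrite -(compm1 f) H compm0 | rewrite -(comp1m f) H comp0m].
Qed.

Lemma iso_invK (X Y : C) (f : hom X Y) (isof : is_iso f) :
  iso_inv isof ∘ f = idm X.
Proof. by rewrite /iso_inv; case: constructive_indefinite_description => g []. Qed.

Lemma iso_invVK (X Y : C) (f : hom X Y) (isof : is_iso f) :
  f ∘ iso_inv isof = idm Y.
Proof. by rewrite /iso_inv; case: constructive_indefinite_description => g []. Qed.

Lemma iso_inv_iso (X Y : C) (f : hom X Y) (isof : is_iso f) :
  is_iso (iso_inv isof).
Proof. by exists f; rewrite iso_invK iso_invVK. Qed.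

Lemma is_iso_comp (X Y Z : C) (g : hom Y Z) (f : hom X Y) :
  is_iso g -> is_iso f -> is_iso (g ∘ f).
Proof.
move=> [g' [g1 g2]] [f' [f1 f2]]; exists (f' ∘ g'); split.
  by rewrite -compmA (compmA g') g1 comp1m.
by rewrite -compmA (compmA f) f2 comp1m.
Qed.

Lemma isomorphic_refl (X : C) : isomorphic X X.
Proof. by exists (idm X), (idm X); rewrite comp1m. Qed.

Lemma isomorphic_sym (X Y : C) : isomorphic X Y -> isomorphic Y X.
Proof. by move=> [f [g [? ?]]]; exists g, f. Qed.

Lemma isomorphic_trans (X Y Z : C) :
  isomorphic X Y -> isomorphic Y Z -> isomorphic X Z.
Proof. by move=> [f ?] [g ?]; exists (g ∘ f); apply: is_iso_comp. Qed.

Lemma is_zero_isomorphic (X Y : C) : isomorphic X Y -> is_zero X -> is_zero Y.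
Proof.
move=> [f [g [_ fg]]] /is_zeroP X0; apply/is_zeroP.
by rewrite -fg -(compm1 f) X0 compm0 comp0m.
Qed.

Lemma fmap_isomorphic (D : linCat k) (F : linFunctor C D) (X Y : C) :
  isomorphic X Y -> isomorphic (F X) (F Y).
Proof.
move=> [f [g [gf fg]]]; exists (fmap F f), (fmap F g).
by rewrite -!fmapM gf fg !fmap1.
Qed.

Lemma fmap_is_iso (D : linCat k) (F : linFunctor C D) (X Y : C) (f : hom X Y) :
  is_iso f -> is_iso (fmap F f).
Proof.
by move=> [g [gf fg]]; exists (fmap F g); rewrite -!fmapM gf fg !fmap1.
Qed.

End LinCatTheory.

Section MonoidalTheory.
Variables (k : fieldType) (C : linCat k) (M : monoidal C).

Lemma tens_isomorphic (X X' Y Y' : C) :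
  isomorphic X X' -> isomorphic Y Y' -> isomorphic (X ⊗[M] Y) (X' ⊗[M] Y').
Proof.
move=> [f [f' [f1 f2]]] [g [g' [g1 g2]]]; exists (f ⊠[M] g), (f' ⊠[M] g').
by rewrite -!tensmM f1 f2 g1 g2 !tensm1.
Qed.

Lemma lunit_isomorphic (X : C) : isomorphic (munit M ⊗[M] X) X.
Proof. by exists (lunit X), (lunitV X); rewrite lunitK lunitVK. Qed.

Lemma runit_isomorphic (X : C) : isomorphic (X ⊗[M] munit M) X.
Proof. by exists (runit X), (runitV X); rewrite runitK runitVK. Qed.

(* Restriction of M to a full subcategory closed under the tensor product, with
   the unit replaced by an isomorphic object of the subcategory and the
   unitors transported accordingly. *)
Variables (P : C -> Prop) (P_tens : forall X Y, P X -> P Y -> P (X ⊗[M] Y)).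
Variables (U : C) (PU : P U) (i : hom (munit M) U) (i_iso : is_iso i).

Let D := full_sub P.
Let j := iso_inv i_iso.
Let ji : j ∘ i = idm _ := iso_invK i_iso.
Let ij : i ∘ j = idm _ := iso_invVK i_iso.

Definition sub_tens (X Y : D) : D :=
  exist P (sval X ⊗[M] sval Y) (P_tens (svalP X) (svalP Y)).

Lemma sub_lunitK (X : C) :
  ((i ⊠[M] idm X) ∘ lunitV X) ∘ (lunit X ∘ (j ⊠[M] idm X)) = idm _.
Proof.
by rewrite -compmA (compmA (lunitV X)) lunitK comp1m -tensmM ij comp1m tensm1.
Qed.

Lemma sub_lunitVK (X : C) :
  (lunit X ∘ (j ⊠[M] idm X)) ∘ ((i ⊠[M] idm X) ∘ lunitV X) = idm _.
Proof.
by rewrite -compmA (compmA (j ⊠[M] _)) -tensmM ji comp1m tensm1 comp1m lunitVK.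
Qed.

Lemma sub_runitK (X : C) :
  ((idm X ⊠[M] i) ∘ runitV X) ∘ (runit X ∘ (idm X ⊠[M] j)) = idm _.
Proof.
by rewrite -compmA (compmA (runitV X)) runitK comp1m -tensmM ij comp1m tensm1.
Qed.

Lemma sub_runitVK (X : C) :
  (runit X ∘ (idm X ⊠[M] j)) ∘ ((idm X ⊠[M] i) ∘ runitV X) = idm _.
Proof.
by rewrite -compmA (compmA (_ ⊠[M] j)) -tensmM ji comp1m tensm1 comp1m runitVK.
Qed.

Lemma sub_lunit_nat (X X' : C) (f : hom X X') :
  (lunit X' ∘ (j ⊠[M] idm X')) ∘ (idm U ⊠[M] f) =
  f ∘ (lunit X ∘ (j ⊠[M] idm X)).
Proof.
rewrite -compmA -tensmM compm1 comp1m (compmA f) -lunit_nat -compmA -tensmM.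
by rewrite compm1 comp1m.
Qed.

Lemma sub_runit_nat (X X' : C) (f : hom X X') :
  (runit X' ∘ (idm X' ⊠[M] j)) ∘ (f ⊠[M] idm U) =
  f ∘ (runit X ∘ (idm X ⊠[M] j)).
Proof.
rewrite -compmA -tensmM compm1 comp1m (compmA f) -runit_nat -compmA -tensmM.
by rewrite compm1 comp1m.
Qed.

Lemma sub_triangle (X Y : C) :
  (idm X ⊠[M] (lunit Y ∘ (j ⊠[M] idm Y))) ∘ assoc X U Y =
  (runit X ∘ (idm X ⊠[M] j)) ⊠[M] idm Y.
Proof.
rewrite -{1}(comp1m (idm X)) tensmM -compmA -assoc_nat compmA triangle.
by rewrite -tensmM comp1m.
Qed.

Definition monoidal_full_sub : monoidal D :=
  @Monoidal k D sub_tens (fun _ _ _ _ f g => f ⊠[M] g) (exist P U PU)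
    (fun X Y Z => @assoc k C M (sval X) (sval Y) (sval Z))
    (fun X Y Z => @assocV k C M (sval X) (sval Y) (sval Z))
    (fun X => lunit (sval X) ∘ (j ⊠[M] idm (sval X)))
    (fun X => (i ⊠[M] idm (sval X)) ∘ lunitV (sval X))
    (fun X => runit (sval X) ∘ (idm (sval X) ⊠[M] j))
    (fun X => (idm (sval X) ⊠[M] i) ∘ runitV (sval X))
    (fun X Y => tensm1 M (sval X) (sval Y))
    (fun _ _ _ _ _ _ f' f g' g => tensmM M f' f g' g)
    (fun X Y Z => assocK M (sval X) (sval Y) (sval Z))
    (fun X Y Z => assocVK M (sval X) (sval Y) (sval Z))
    (fun X => sub_lunitK (sval X)) (fun X => sub_lunitVK (sval X))
    (fun X => sub_runitK (sval X)) (fun X => sub_runitVK (sval X))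
    (fun _ _ _ _ _ _ f g h => assoc_nat M f g h)
    (fun _ _ f => sub_lunit_nat f) (fun _ _ f => sub_runit_nat f)
    (fun X Y Z W => pentagon M (sval X) (sval Y) (sval Z) (sval W))
    (fun X Y => sub_triangle (sval X) (sval Y)).

End MonoidalTheory.

Section TriTheory.
Variables (k : fieldType) (T : triCat k).

Local Notation Σ := (shift T).
Local Notation Ω := (unshift T).

Lemma shiftK_isomorphic (X : T) : isomorphic (Ω (Σ X)) X.
Proof. by exists (shiftK X); apply: shiftK_iso. Qed.

Lemma unshiftK_isomorphic (X : T) : isomorphic (Σ (Ω X)) X.
Proof. by exists (unshiftK X); apply: unshiftK_iso. Qed.

Lemma shift_inj (X Y : T) (f g : hom X Y) : fmap Σ f = fmap Σ g -> f = g.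
Proof.
move=> e; have [s [_ s2]] := shiftK_iso X.
by rewrite -(compm1 f) -(compm1 g) -s2 !compmA -!shiftK_nat e.
Qed.

Lemma unshift_inj (X Y : T) (f g : hom X Y) : fmap Ω f = fmap Ω g -> f = g.
Proof.
move=> e; have [s [_ s2]] := unshiftK_iso X.
by rewrite -(compm1 f) -(compm1 g) -s2 !compmA -!unshiftK_nat e.
Qed.

Lemma shift_full (X Y : T) (f : hom (Σ X) (Σ Y)) : exists g, fmap Σ g = f.
Proof.
have [s [s1 s2]] := shiftK_iso X; have [r [r1 r2]] := shiftK_iso Y.
exists (shiftK Y ∘ fmap Ω f ∘ s); apply: unshift_inj.
rewrite -[LHS]comp1m -r1 -compmA shiftK_nat -!compmA s1 compm1.
by rewrite compmA r1 comp1m.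
Qed.

Lemma shift_zero (X : T) : is_zero X -> is_zero (Σ X).
Proof. by move=> /is_zeroP X0; apply/is_zeroP; rewrite -fmap1 X0 fmap0. Qed.

Lemma shift_zeroV (X : T) : is_zero (Σ X) -> is_zero X.
Proof.
move=> /is_zeroP X0; apply/is_zeroP/shift_inj; by rewrite fmap1 X0 fmap0.
Qed.

Section Dist.
Variables (X Y Z : T) (f : hom X Y) (g : hom Y Z) (h : hom Z (Σ X)).
Hypothesis fgh : dist f g h.

Lemma dist_comp0 : g ∘ f = 0.
Proof.
have [[O O0] _] := tri_add T.
have [|c [<- _]] := dist_mor (dist_id X O0) fgh (a := idm X) (b := f).
  by [].
by rewrite compm0.
Qed.

Lemma dist_rot1 : dist g h (- fmap Σ f).
Proof. exact: (proj1 (dist_rot _ _ _) fgh). Qed.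

Lemma dist_lift W (u : hom W Y) : g ∘ u = 0 -> exists v, f ∘ v = u.
Proof.
move=> gu; have [[O O0] _] := tri_add T.
have [|c []] := dist_mor (proj1 (dist_rot _ _ _) (dist_id W O0)) dist_rot1
  (a := u) (b := 0).
  by rewrite comp0m gu.
have [v <-] := shift_full c => _ e; exists v; apply: shift_inj.
by move/eqP: e; rewrite fmap1 compmN compm1 compNm eqr_opp fmapM => /eqP.
Qed.

Lemma dist_colift W (u : hom Y W) : u ∘ f = 0 -> exists v, v ∘ g = u.
Proof.
move=> uf; have [[O O0] _] := tri_add T.
have d : dist (0 : hom O W) (idm W) (0 : hom W (Σ O)).
  apply/dist_rot; rewrite fmap0 oppr0; apply: dist_id; exact: shift_zero.
have [|c [e _]] := dist_mor fgh d (a := 0) (b := u).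
  by rewrite uf compm0.
by exists c; rewrite e comp1m.
Qed.

End Dist.

Section Dist2.
Variables (X Y Z : T) (f : hom X Y) (g : hom Y Z) (h : hom Z (Σ X)).
Hypothesis fgh : dist f g h.

Lemma dist_rot3 : dist (- fmap Σ f) (- fmap Σ g) (- fmap Σ h).
Proof. exact: dist_rot1 (dist_rot1 (dist_rot1 fgh)). Qed.

Lemma dist_zero3_iso : is_zero Z -> is_iso f.
Proof.
move=> Z0; have [s fs] : exists s, f ∘ s = idm Y.
  by apply: (dist_lift fgh); apply: (proj2 (Z0 Y)).
exists s; split => //; apply: shift_inj.
have [v hv] : exists v, h ∘ v = fmap Σ (s ∘ f) - idm (Σ X).
  apply: (dist_lift (dist_rot1 (dist_rot1 fgh))); rewrite compNm.
  by rewrite compmB compm1 -fmapM compmA fs comp1m subrr oppr0.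
apply/eqP; rewrite fmap1 -subr_eq0 -hv.
by rewrite (proj2 (Z0 (Σ X)) v) compm0.
Qed.

Lemma dist_zero1_iso : is_zero X -> is_iso g.
Proof.
move=> X0; have X0' := shift_zero X0.
have [s fs] : exists s, g ∘ s = idm Z.
  by apply: (dist_lift (dist_rot1 fgh)); apply: (proj2 (X0' Z)).
have [r rg] : exists r, r ∘ g = idm Y.
  by apply: (dist_colift fgh); apply: (proj1 (X0 Y)).
exists r; split => //.
by rewrite -[RHS]fs -(comp1m s) -rg -(compmA r) fs compm1.
Qed.

Lemma dist_zero1 : f = 0 -> (forall v : hom (Σ X) Z, v = 0) -> is_zero X.
Proof.
move=> f0 v0; apply/is_zeroP/shift_inj; rewrite fmap1 fmap0.
have [v <-] : exists v, h ∘ v = idm (Σ X).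
  apply: (dist_lift (dist_rot1 (dist_rot1 fgh))).
  by rewrite f0 fmap0 oppr0 comp0m.
by rewrite (v0 v) compm0.
Qed.

Lemma dist_zero3 : g = 0 -> (forall v : hom (Σ X) Z, v = 0) -> is_zero Z.
Proof.
move=> g0 v0; apply/is_zeroP.
have [v <-] : exists v, v ∘ h = idm Z.
  by apply: (dist_colift (dist_rot1 fgh)); rewrite g0 compm0.
by rewrite (v0 v) comp0m.
Qed.

Lemma dist_zero2 : is_zero X -> is_zero Z -> is_zero Y.
Proof.
move=> X0 Z0; apply: is_zero_isomorphic X0.
by exists f; apply: dist_zero3_iso.
Qed.

End Dist2.

Lemma hom_unshift0 (A X : T) :
  (forall f : hom (Σ A) X, f = 0) <-> (forall f : hom A (Ω X), f = 0).
Proof.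
have [s [s1 s2]] := unshiftK_iso X; split=> H f.
  apply: shift_inj; rewrite fmap0 -[LHS]comp1m -s1 -compmA.
  by rewrite (H (_ ∘ _)) compm0.
have [g eg] := shift_full (s ∘ f).
by rewrite -[f]comp1m -s2 -compmA -eg (H g) fmap0 compm0.
Qed.

Lemma hom_iter_unshift0 j (A X : T) :
  (forall f : hom (iter j Σ A) X, f = 0) <->
  (forall f : hom A (iter j Ω X), f = 0).
Proof.
elim: j A X => // j IH A X.
rewrite iterSr IH; split=> H.
  by rewrite iterS; apply/hom_unshift0.
by apply/hom_unshift0; rewrite -iterS.
Qed.

Lemma iter_isomorphic (F : linFunctor T T) j (X Y : T) :
  isomorphic X Y -> isomorphic (iter j F X) (iter j F Y).
Proof. by move=> e; elim: j => //= j IH; apply: fmap_isomorphic. Qed.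

Lemma iter_shiftK j (X : T) : isomorphic (iter j Ω (iter j Σ X)) X.
Proof.
elim: j => [|j IH]; first exact: isomorphic_refl.
rewrite iterSr iterS; apply: isomorphic_trans IH.
by apply/iter_isomorphic/shiftK_isomorphic.
Qed.

Lemma iter_unshiftK j (X : T) : isomorphic (iter j Σ (iter j Ω X)) X.
Proof.
elim: j => [|j IH]; first exact: isomorphic_refl.
rewrite iterSr iterS; apply: isomorphic_trans IH.
by apply/iter_isomorphic/unshiftK_isomorphic.
Qed.

End TriTheory.

Section TStructureTheory.
Variables (k : fieldType) (T : triCat k) (t : tstructure T).

Local Notation Σ := (shift T).
Local Notation Ω := (unshift T).

Lemma tle0_orth X :
  (forall Y, tge1 t Y -> forall f : hom X Y, f = 0) -> tle0 t X.
Proof.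
move=> H; have [A [B [f [g [h [A0 B0 d]]]]]] := t_triangle t X.
apply: (tle0_strict _ A0); exists f; apply: (dist_zero3_iso d).
apply: (dist_zero3 d); first exact: H.
by apply: tle0_tge1 B0; apply: tle0_shift.
Qed.

Lemma tge1_orth X :
  (forall Y, tle0 t Y -> forall f : hom Y X, f = 0) -> tge1 t X.
Proof.
move=> H; have [A [B [f [g [h [A0 B0 d]]]]]] := t_triangle t X.
apply: (tge1_strict _ B0); apply: isomorphic_sym; exists g.
apply: (dist_zero1_iso d); apply: (dist_zero1 d); first exact: H.
by apply: tle0_tge1 B0; apply: tle0_shift.
Qed.

Lemma tle0_ext X Y Z (f : hom X Y) (g : hom Y Z) (h : hom Z (Σ X)) :
  dist f g h -> tle0 t X -> tle0 t Z -> tle0 t Y.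
Proof.
move=> d X0 Z0; apply: tle0_orth => W W0 u.
have [v <-] := dist_colift d (tle0_tge1 X0 W0 (u ∘ f)).
by rewrite (tle0_tge1 Z0 W0 v) comp0m.
Qed.

Lemma tge1_unshift X : tge1 t X -> tge1 t (Ω X).
Proof.
move=> /tge1_shift [Y Y0 e]; apply: tge1_strict Y0.
apply: isomorphic_trans (isomorphic_sym (shiftK_isomorphic Y)) _.
by apply: fmap_isomorphic; apply: isomorphic_sym.
Qed.

Lemma tle0_iter_shift j X : tle0 t X -> tle0 t (iter j Σ X).
Proof. by move=> X0; elim: j => //= j; apply: tle0_shift. Qed.

Lemma tge1_iter_unshift j X : tge1 t X -> tge1 t (iter j Ω X).
Proof. by move=> X0; elim: j => //= j; apply: tge1_unshift. Qed.

Lemma tge1_iterP j X :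
  tge1 t (iter j Ω X) <->
  forall A, tle0 t A -> forall f : hom (iter j Σ A) X, f = 0.
Proof.
split=> [X0 A A0|H]; last first.
  by apply: tge1_orth => A A0; apply/hom_iter_unshift0/H.
exact: (proj2 (hom_iter_unshift0 j A X) (tle0_tge1 A0 X0)).
Qed.

Lemma Dle0P X : Dle t 0 X <-> tle0 t X.
Proof.
split=> [[Y Y0 e]|X0]; last by exists X => //; apply: isomorphic_refl.
by apply: tle0_strict Y0; apply: isomorphic_sym.
Qed.

Lemma Dge0P X : Dge t 0 X <-> tge1 t (Ω X).
Proof.
split=> [[Y Y0 e]|X0].
  apply: tge1_strict Y0; apply: isomorphic_sym.
  exact: isomorphic_trans (fmap_isomorphic Ω e) (shiftK_isomorphic Y).
by exists (Ω X) => //; apply/isomorphic_sym/unshiftK_isomorphic.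
Qed.

Lemma Dge0_shift X : Dge t 0 (Σ X) <-> tge1 t X.
Proof.
split=> [/Dge0P|] X0; last apply/Dge0P; apply: tge1_strict X0.
  exact: shiftK_isomorphic.
exact/isomorphic_sym/shiftK_isomorphic.
Qed.

Lemma in_heart_strict X Y : isomorphic X Y -> in_heart t X -> in_heart t Y.
Proof.
move=> e [/Dle0P X0 /Dge0P X1]; split; [apply/Dle0P|apply/Dge0P].
  exact: tle0_strict X0.
by apply: tge1_strict X1; apply: fmap_isomorphic.
Qed.

Lemma t_bounded_le : t_bounded t -> forall X, exists m, tle0 t (iter m Σ X).
Proof.
case=> b _ X; have [[m|m] [Y Y0]] := b X; last first.
  move=> e; exists 0%N; apply: tle0_strict (isomorphic_sym e) _.
  exact: tle0_iter_shift.
case: m => [|m] e; first by exists 0%N; apply: tle0_strict (isomorphic_sym e) _.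
exists m.+1; apply: tle0_strict Y0; apply: isomorphic_sym.
apply: isomorphic_trans (iter_isomorphic Σ m.+1 e) _.
exact: (iter_unshiftK m.+1).
Qed.

Lemma t_bounded_ge : t_bounded t -> forall X, exists m, tge1 t (iter m Ω X).
Proof.
case=> _ b X; have [n [Y Y0]] := b X; case: (- (n - 1)) => m e.
  exists m; apply: tge1_strict Y0; apply: isomorphic_sym.
  by apply: isomorphic_trans (iter_isomorphic Ω m e) _; apply: iter_shiftK.
exists 0%N; apply: tge1_strict (isomorphic_sym e) _.
exact: (tge1_iter_unshift m.+1).
Qed.

Section HeartInd.
Variable N : T -> Prop.
Hypothesis N_iso : forall X Y, isomorphic X Y -> N X -> N Y.
Hypothesis N_shift : forall X, N (Σ X) <-> N X.
Hypothesis N_dist : forall X Y Z (f : hom X Y) (g : hom Y Z) (h : hom Z (Σ X)),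
  dist f g h -> N X -> N Z -> N Y.
Hypothesis N_heart : forall X, in_heart t X -> N X.

Lemma heart_ind_le m Y : tle0 t Y -> tge1 t (iter m.+1 Ω Y) -> N Y.
Proof.
elim: m Y => [|m IH] Y Y0 Y1.
  by apply: N_heart; split; [apply/Dle0P|apply/Dge0P].
have [P [Q [a [b [h [P0 Q0 d]]]]]] := t_triangle t (Ω Y).
apply: (N_iso (unshiftK_isomorphic Y)); apply/N_shift; apply: (N_dist d).
  apply: IH => //; apply/tge1_iterP => A A0 f.
  have af0 : a ∘ f = 0.
    by move: f => f; apply: (proj1 (tge1_iterP m.+1 (Ω Y)) _ _ A0);
      rewrite -iterSr.
  have [|v hv] := dist_lift (dist_rot1 (dist_rot1 d)) (u := fmap Σ f).
    by rewrite compNm -fmapM af0 fmap0 oppr0.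
  apply: shift_inj; rewrite -hv fmap0 (tle0_tge1 _ Q0 v) ?compm0 //.
  exact: (tle0_iter_shift m.+2).
apply/N_shift/N_heart; split; last by apply/Dge0_shift.
apply/Dle0P; apply: (tle0_ext (dist_rot1 (dist_rot3 d))).
  by apply: tle0_strict Y0; apply/isomorphic_sym/unshiftK_isomorphic.
exact: (tle0_iter_shift 2).
Qed.

Lemma heart_ind : t_bounded t -> forall X, N X.
Proof.
move=> tb X; have [m X0] := t_bounded_le tb X; have [n X1] := t_bounded_ge tb X.
suff: N (iter m Σ X) by elim: m {X0} => //= m IH /N_shift.
apply: (heart_ind_le (m := n + m)%N) => //; rewrite iterS iterD.
apply/tge1_unshift; apply: tge1_strict X1.
exact/iter_isomorphic/isomorphic_sym/iter_shiftK.
Qed.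

End HeartInd.

End TStructureTheory.

Section HeartMonoidal.
Variables (k : fieldType) (T : monTriCat k) (t : tstructure T).

Local Notation Σ := (shift T).
Local Notation Ω := (unshift T).
Local Notation "X ⊗ Y" := (X ⊗[T] Y) (at level 35, right associativity).
Local Notation one := (munit T).

Lemma shiftl_isomorphic (X Y : T) : isomorphic (Σ X ⊗ Y) (Σ (X ⊗ Y)).
Proof. by exists (shiftl X Y); apply: shiftl_iso. Qed.

Lemma shiftr_isomorphic (X Y : T) : isomorphic (X ⊗ Σ Y) (Σ (X ⊗ Y)).
Proof. by exists (shiftr X Y); apply: shiftr_iso. Qed.

Hypothesis tm : monoidal_tstructure t.
Hypothesis dev0 : dev t 0.

Lemma heart_tens X Y : in_heart t X -> in_heart t Y -> in_heart t (X ⊗ Y).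
Proof.
by case: dev0 => le ge [X0 X1] [Y0 Y1]; split; [apply: le|apply: ge].
Qed.

Lemma tens_heart_zero B : (forall X, in_heart t X -> is_zero (B ⊗ X)) -> is_zero B.
Proof.
move=> H; apply: is_zero_isomorphic (runit_isomorphic T B) _.
apply: (@heart_ind _ _ t (fun X => is_zero (B ⊗ X))) => //; last by case: tm.
- move=> X Y e; apply: is_zero_isomorphic; apply: tens_isomorphic e.
  exact: isomorphic_refl.
- move=> X; split=> [/(is_zero_isomorphic (shiftr_isomorphic B X))|X0].
    exact: shift_zeroV.
  apply: is_zero_isomorphic (isomorphic_sym (shiftr_isomorphic B X)) _.
  exact: shift_zero.
- by move=> X Y Z f g h d; apply: dist_zero2 (tens_exactr B d).
Qed.

Lemma unit_tle0 : tle0 t one.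
Proof.
have [A [B [f [g [h [A0 B0 d]]]]]] := t_triangle t one.
apply: (tle0_strict _ A0); exists f; apply: (dist_zero3_iso d).
apply: tens_heart_zero => X [X0 X1]; have [le ge] := dev0.
have dX := tens_exactl X d.
have AX : tle0 t (A ⊗ X) by apply/Dle0P/le => //; apply/Dle0P.
have BX : tge1 t (B ⊗ X).
  apply/Dge0_shift/Dge0P; apply: tge1_strict (fmap_isomorphic _ _) _.
    exact: shiftl_isomorphic.
  by apply/Dge0P/ge => //; apply/Dge0_shift.
apply: (dist_zero3 dX); apply: (tle0_tge1 _ BX); last exact: tle0_shift.
apply: tle0_strict (isomorphic_sym (lunit_isomorphic T X)) _.
exact/Dle0P.
Qed.

Lemma unit_tge1 : tge1 t (Ω one).
Proof.
have [P [Q [a [b [h [P0 Q0 /dist_rot3 d]]]]]] := t_triangle t (Ω one).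
have e := unshiftK_isomorphic one.
apply: (tge1_strict _ Q0); apply: isomorphic_sym.
apply: isomorphic_trans (shiftK_isomorphic Q); apply: fmap_isomorphic.
apply: isomorphic_trans (isomorphic_sym e) _.
eexists; apply: (dist_zero1_iso d).
apply: tens_heart_zero => X [X0 X1]; have [le ge] := dev0.
have dX := tens_exactl X d.
have PX : tle0 t (P ⊗ X) by apply/Dle0P/le => //; apply/Dle0P.
have QX : tge1 t (Ω (Σ Q ⊗ X)) by apply/Dge0P/ge => //; apply/Dge0_shift.
have IX : tge1 t (Ω (Σ (Ω one) ⊗ X)).
  apply: (tge1_strict _ (proj1 (Dge0P _ _) X1)); apply: fmap_isomorphic.
  apply: isomorphic_trans (isomorphic_sym (lunit_isomorphic T X)) _.
  by apply: tens_isomorphic (isomorphic_refl _); apply: isomorphic_sym.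
have [s [s1 s2]] := shiftl_iso P X.
have K Z : tge1 t (Ω Z) -> forall v : hom (Σ P ⊗ X) Z, v = 0.
  move=> Z0 v; rewrite -[v]compm1 -s1 compmA.
  by rewrite (proj2 (hom_unshift0 (P ⊗ X) Z) (tle0_tge1 PX Z0) (v ∘ s)) comp0m.
apply: (dist_zero1 dX); first exact: K.
apply/hom_unshift0; apply: tle0_tge1 QX; apply: tle0_strict.
  exact/isomorphic_sym/shiftl_isomorphic.
exact: tle0_shift.
Qed.

Lemma unit_in_heart : in_heart t one.
Proof. by split; [apply/Dle0P/unit_tle0|apply/Dge0P/unit_tge1]. Qed.

Lemma to_tau_ge0_unit_iso : is_iso (to_tau_ge0 t one).
Proof.
apply: is_iso_comp; last exact: iso_inv_iso.
apply: fmap_is_iso; have d := tau_dist (trunc t (Ω one)).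
apply: (dist_zero1_iso d); apply: (dist_zero1 d).
  exact: (tle0_tge1 (tau_le0P _) unit_tge1).
by apply: (tle0_tge1 _ (tau_ge1P _)); apply/tle0_shift/tau_le0P.
Qed.

Lemma tau_le0_to_unit_iso : is_iso (tau_le0_to (trunc t (tau_ge0 t one))).
Proof.
have d := tau_dist (trunc t (tau_ge0 t one)).
have u0 : tle0 t (tau_ge0 t one).
  by apply: tle0_strict unit_tle0; eexists; apply: to_tau_ge0_unit_iso.
apply: (dist_zero3_iso d); apply: (dist_zero3 d).
  exact: (tle0_tge1 u0 (tau_ge1P _)).
by apply: (tle0_tge1 _ (tau_ge1P _)); apply/tle0_shift/tau_le0P.
Qed.

(* The canonical isomorphism from the unit of T to H^0 of it, through the
   truncation morphisms. *)
Definition unit_to_H0 : hom one (H0 t one) :=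
  iso_inv tau_le0_to_unit_iso ∘ to_tau_ge0 t one.

Lemma unit_to_H0_iso : is_iso unit_to_H0.
Proof.
exact: is_iso_comp (iso_inv_iso _) to_tau_ge0_unit_iso.
Qed.

Lemma H0_unit_in_heart : in_heart t (H0 t one).
Proof.
apply: in_heart_strict unit_in_heart.
by exists unit_to_H0; apply: unit_to_H0_iso.
Qed.

(* Since the unit of T lies in the heart (unit_in_heart), H^0 of it is canonically
   isomorphic to it; the unitors below are transported along that isomorphism. *)
Definition heart_monoidal : monoidal (heart t) :=
  monoidal_full_sub heart_tens H0_unit_in_heart unit_to_H0_iso.

End HeartMonoidal.

Arguments heart_monoidal {k T t} tm dev0.

(* Main.v *)
From mathcomp Require Import all_boot all_algebra.
Require Import Defs.

Import GRing.Theory.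
Local Open Scope ring_scope.

Set Implicit Arguments.
Unset Strict Implicit.

(** Duality exchanges the two halves of the t-structure because the tensor unit
lies in both of them ([unit_in_heart]). If [Y] is the left dual of [X], then
[- ⊗ Y] is right adjoint to [- ⊗ X], so that
[Hom(A, Y) = Hom(A ⊗ X, 1)], and [Y ⊗ -] is left adjoint to [X ⊗ -], so that
[Hom(Y, B) = Hom(1, X ⊗ B)].
For [X] in [D^{<=0}] and [A] in [D^{<=-1}] the object [A ⊗ X] is in
[D^{<=-1}], hence has no nonzero map to [1], which is in [D^{>=0}]; therefore
[Y] is in [D^{>=0}]. For [X] in [D^{>=0}] and [B] in [D^{>=1}] the object
[X ⊗ B] is in [D^{>=1}], hence receives no nonzero map from [1], which is in
[D^{<=0}]; therefore [Y] is in [D^{<=0}]. Only the injectivity of the adjunction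
maps enters, and it is a direct consequence of the zigzag identities
([zigzag_ev_l], [zigzag_coev_r] and their mirror images for right duals).

Consequently the dual of an object of the heart is again in the heart, and the
zigzag identities survive the replacement of [1] by the isomorphic unit
[H^0(1)] ([zigzag_full_sub]); this gives the duals of the heart.

For the last claim the heart must be abelian ([heart_abelian]). The kernel and
the cokernel of [f] are read off from one object: if [Z] is the cone of [f], the
truncation triangle [Σ K -> Z -> Q] of [Z] with respect to
[(D^{<=-1}, D^{>=0})] has [K = ker f] and [Q = coker f]
([heart_kernel_cokernel]). When [K = 0] the map [f] is the kernel of its
cokernel, and when [Q = 0] it is the cokernel of its kernel, because the cone of
[f] is then [Q], respectively [Σ K]. *)

(** * Linear categories *)

Section LinearCategories.
Variables (k : fieldType) (C : linCat k).

Lemma compmD (X Y Z : C) (g : hom Y Z) (u v : hom X Y) :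
  g ∘ (u + v) = g ∘ u + g ∘ v.
Proof. by have := compm_linr g 1 u v; rewrite /= !scale1r. Qed.

Lemma compDm (X Y Z : C) (u v : hom Y Z) (f : hom X Y) :
  (u + v) ∘ f = u ∘ f + v ∘ f.
Proof. by have := compm_linl f 1 u v; rewrite /= !scale1r. Qed.

Lemma hom_iso_source0 (A A' B : C) : isomorphic A' A ->
  (forall f : hom A B, f = 0) -> forall f : hom A' B, f = 0.
Proof.
by move=> [s [r [rs _]]] H f; rewrite -(compm1 f) -rs compmA (H (f ∘ r)) comp0m.
Qed.

Lemma End_iso_base_isomorphic (X Y : C) :
  isomorphic X Y -> End_iso_base X -> End_iso_base Y.
Proof.
move=> [i [j [ji ij]]] [phi [[psi pK qK] lin p1 pM]].
exists (fun a => i ∘ phi a ∘ j); split.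
- exists (fun f => psi (j ∘ f ∘ i)) => [a|f].
    by rewrite !compmA ji comp1m -compmA ji compm1.
  by rewrite qK !compmA ij comp1m -compmA ij compm1.
- by move=> a x y; rewrite lin (compm_linr i) (compm_linl j).
- by rewrite p1 compm1.
- by move=> a b; rewrite pM !compmA -(compmA _ j) ji compm1.
Qed.

End LinearCategories.

(** * Duals in a bilinear monoidal category *)

Section Duals.
Variables (k : fieldType) (C : linCat k) (M : monoidal C).
Hypothesis bil : tens_bilinear M.

Lemma tens0m (X X' Y Y' : C) (g : hom Y Y') : (0 : hom X X') ⊠[M] g = 0.
Proof. exact: (linear_fun0 (proj1 bil X X' Y Y' g)). Qed.

Lemma tensm0 (X X' Y Y' : C) (f : hom X X') : f ⊠[M] (0 : hom Y Y') = 0.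
Proof. exact: (linear_fun0 (proj2 bil X X' Y Y' f)). Qed.

Lemma assocV_nat (X X' Y Y' Z Z' : C)
    (f : hom X X') (g : hom Y Y') (h : hom Z Z') :
  assocV X' Y' Z' ∘ (f ⊠[M] (g ⊠[M] h)) = ((f ⊠[M] g) ⊠[M] h) ∘ assocV X Y Z.
Proof.
rewrite -[LHS]compm1 -(assocVK M) -compmA (compmA (f ⊠[M] _)) -assoc_nat.
by rewrite -!compmA (compmA (assocV _ _ _)) assocK comp1m.
Qed.

Lemma lunitV_nat (X X' : C) (f : hom X X') :
  (idm (munit M) ⊠[M] f) ∘ lunitV X = lunitV X' ∘ f.
Proof.
rewrite -[LHS]comp1m -(lunitK M) -!compmA; congr (_ ∘ _).
by rewrite compmA lunit_nat -compmA lunitVK compm1.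
Qed.

Lemma runitV_nat (X X' : C) (f : hom X X') :
  (f ⊠[M] idm (munit M)) ∘ runitV X = runitV X' ∘ f.
Proof.
rewrite -[LHS]comp1m -(runitK M) -!compmA; congr (_ ∘ _).
by rewrite compmA runit_nat -compmA runitVK compm1.
Qed.

Lemma tensm_swap (X X' Y Y' : C) (f : hom X X') (g : hom Y Y') :
  (idm X' ⊠[M] g) ∘ (f ⊠[M] idm Y) = (f ⊠[M] idm Y') ∘ (idm X ⊠[M] g).
Proof. by rewrite -!tensmM !comp1m !compm1. Qed.

Lemma tensml (X X' X'' Y : C) (f' : hom X' X'') (f : hom X X') :
  (f' ∘ f) ⊠[M] idm Y = (f' ⊠[M] idm Y) ∘ (f ⊠[M] idm Y).
Proof. by rewrite -tensmM comp1m. Qed.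

Lemma tensmr (X Y Y' Y'' : C) (g' : hom Y' Y'') (g : hom Y Y') :
  idm X ⊠[M] (g' ∘ g) = (idm X ⊠[M] g') ∘ (idm X ⊠[M] g).
Proof. by rewrite -tensmM comp1m. Qed.

Section Zigzag.
Variables (X Y : C) (ev : hom (Y ⊗[M] X) (munit M)).
Variable coev : hom (munit M) (X ⊗[M] Y).
Hypothesis zz : zigzag ev coev.

(** The map [f |-> ev ∘ (f ⊗ X)] from [Hom(A, Y)] to [Hom(A ⊗ X, 1)] is the
adjunction bijection; the second zigzag identity rebuilds [f] from its image, so
the image cannot vanish unless [f] does. The next three lemmas are the same
statement for the other three adjunctions of a dual pair. *)
Lemma zigzag_ev_l (A : C) (f : hom A Y) : ev ∘ (f ⊠[M] idm X) = 0 -> f = 0.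
Proof.
move=> H; rewrite -(comp1m f) -(proj2 zz) -!compmA -runitV_nat.
rewrite (compmA (idm Y ⊠[M] _)) tensm_swap -compmA -(tensm1 M X Y).
rewrite (compmA (assocV _ _ _)) assocV_nat -compmA (compmA (ev ⊠[M] _)).
by rewrite -tensml H tens0m comp0m compm0.
Qed.

Lemma zigzag_coev_r (B : C) (f : hom Y B) : (idm X ⊠[M] f) ∘ coev = 0 -> f = 0.
Proof.
move=> H; rewrite -(compm1 f) -(proj2 zz) !compmA -lunit_nat.
rewrite -(compmA (lunit B)) tensm_swap -(tensm1 M Y X) !compmA.
rewrite -(compmA _ ((idm Y ⊠[M] idm X) ⊠[M] f)) -assocV_nat -!compmA.
by rewrite (compmA (idm Y ⊠[M] _)) -tensmr H tensm0 comp0m !compm0.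
Qed.

Lemma zigzag_ev_r (A : C) (f : hom A X) : ev ∘ (idm Y ⊠[M] f) = 0 -> f = 0.
Proof.
move=> H; rewrite -(comp1m f) -(proj1 zz) -!compmA -lunitV_nat.
rewrite (compmA (coev ⊠[M] _)) -tensm_swap -compmA -(tensm1 M X Y).
rewrite (compmA (assoc _ _ _)) assoc_nat -compmA (compmA (idm X ⊠[M] ev)).
by rewrite -tensmr H tensm0 comp0m compm0.
Qed.

Lemma zigzag_coev_l (B : C) (f : hom X B) : (f ⊠[M] idm Y) ∘ coev = 0 -> f = 0.
Proof.
move=> H; rewrite -(compm1 f) -(proj1 zz) !compmA -runit_nat.
rewrite -(compmA (runit B)) -tensm_swap -(tensm1 M Y X) !compmA.
rewrite -(compmA _ (f ⊠[M] (idm Y ⊠[M] idm X))) -assoc_nat -!compmA.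
by rewrite (compmA ((f ⊠[M] _) ⊠[M] _)) -tensml H tens0m comp0m !compm0.
Qed.

End Zigzag.

Section FullSub.
Variables (P : C -> Prop) (P_tens : forall X Y, P X -> P Y -> P (X ⊗[M] Y)).
Variables (U : C) (PU : P U) (i : hom (munit M) U) (i_iso : is_iso i).
Let N := monoidal_full_sub P_tens PU i_iso.

(** The isomorphism [i] inserted in the evaluation meets its inverse inside the
transported unitor of the subcategory, and likewise for the coevaluation. *)
Lemma zigzag_full_sub (X Y : full_sub P)
    (ev : hom (sval Y ⊗[M] sval X) (munit M))
    (coev : hom (munit M) (sval X ⊗[M] sval Y)) :
  zigzag ev coev ->
  @zigzag k (full_sub P) N X Y (i ∘ ev) (coev ∘ iso_inv i_iso).
Proof.
case: X Y ev coev => [X PX] [Y PY] /= ev coev [z1 z2].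
split; [rewrite -[RHS]z1|rewrite -[RHS]z2] => /=.
  rewrite -!compmA (compmA (idm X ⊠[M] iso_inv i_iso)) -tensmr.
  rewrite (compmA (iso_inv i_iso)) iso_invK comp1m.
  by rewrite (compmA (_ ⊠[M] idm X)) -tensml -compmA iso_invK compm1.
rewrite -!compmA (compmA (iso_inv i_iso ⊠[M] idm Y)) -tensml.
rewrite (compmA (iso_inv i_iso)) iso_invK comp1m.
by rewrite (compmA (idm Y ⊠[M] _)) -tensmr -compmA iso_invK compm1.
Qed.

Lemma bilinear_full_sub : tens_bilinear N.
Proof. by split=> X X' Y Y'; [apply: (proj1 bil)|apply: (proj2 bil)]. Qed.

End FullSub.
End Duals.

(** * The heart is abelian *)

Section HeartAbelian.
Variables (k : fieldType) (T : triCat k) (t : tstructure T).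
Local Notation Σ := (shift T).
Local Notation Ω := (unshift T).

Lemma Dge0_homP X :
  Dge t 0 X <-> forall A, tle0 t A -> forall f : hom (Σ A) X, f = 0.
Proof. by rewrite Dge0P; apply: (tge1_iterP t 1). Qed.

Lemma in_heartP X : in_heart t X <-> tle0 t X /\ Dge t 0 X.
Proof. by rewrite /in_heart Dle0P. Qed.

Lemma heart_additive : additive_cat (heart t).
Proof.
have [[O O0] bip] := tri_add T; split.
  have hO : in_heart t O.
    apply/in_heartP; split.
      by apply: tle0_orth => W _; case: (O0 W).
    by apply/Dge0_homP => A _; case: (O0 (Σ A)).
  by exists (exist _ O hO) => -[Y hY]; apply: O0.
move=> [X hX] [Y hY]; have /in_heartP[X0 /Dge0_homP X1] := hX.
have /in_heartP[Y0 /Dge0_homP Y1] := hY.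
have [S bS] := bip X Y; have [i1 [i2 [p1 [p2 [_ _ _ _ e]]]]] := bS.
have hS : in_heart t S.
  apply/in_heartP; split.
    apply: tle0_orth => W W1 f; rewrite -(compm1 f) -e compmD !compmA.
    by rewrite (tle0_tge1 X0 W1 (f ∘ i1)) (tle0_tge1 Y0 W1 (f ∘ i2)) !comp0m addr0.
  apply/Dge0_homP => A A0 f; rewrite -(comp1m f) -e compDm -!compmA.
  by rewrite (X1 A A0 (p1 ∘ f)) (Y1 A A0 (p2 ∘ f)) !compm0 addr0.
by exists (exist _ S hS).
Qed.

(** Exactness of [Hom(Σ W, -)] at [Σ X]; the signs that rotation introduces are
absorbed here. *)
Lemma dist_shift_lift X Y Z W (f : hom X Y) (g : hom Y Z) (h : hom Z (Σ X))
    (u : hom (Σ W) (Σ X)) :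
  dist f g h -> fmap Σ f ∘ u = 0 -> exists v, h ∘ v = u.
Proof.
move=> d fu; apply: (dist_lift (dist_rot1 (dist_rot1 d))).
by rewrite compNm fu oppr0.
Qed.

(** This is truncation for the t-structure [(D^{<=-1}, D^{>=0})], obtained by
suspending the truncation triangle of the desuspension of [Z]: suspending a
triangle is rotating it three times, which puts a sign on each of its maps. *)
Lemma trunc_triangle_shift (Z : T) :
  exists K Q (a : hom (Σ K) Z) (c : hom Z Q) (e : hom Q (Σ (Σ K))),
  [/\ tle0 t K, Dge t 0 Q & dist a c e].
Proof.
have [K [Q [a [c [e [K0 Q1 d]]]]]] := t_triangle t (Ω Z).
have z := unshiftK_iso Z.
exists K, (Σ Q), (unshiftK Z ∘ (- fmap Σ a)), ((- fmap Σ c) ∘ iso_inv z).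
exists (- fmap Σ e); split=> //; first by apply/Dge0_shift.
have idI (W : T) : is_iso (idm W) by exists (idm W); rewrite comp1m.
apply: (dist_iso (a := idm _) (b := unshiftK Z) (c := idm _) (idI _) z (idI _)
  _ _ _ (dist_rot3 d)).
- by rewrite compm1.
- by rewrite comp1m -compmA iso_invK compm1.
- by rewrite fmap1 comp1m compm1.
Qed.

(** The kernel of [f] is the [K], and the cokernel the [Q], of the truncation
triangle of the cone [Z] of [f]: a map from [D^{<=0}] to [X] killed by [f] lifts,
after a shift, to [Z], and then to [Σ K] since [Q] is in [D^{>=0}]; dually for
cokernels. The last two clauses are the two halves of the statement that a
morphism with zero kernel is a kernel and one with zero cokernel is a cokernel. *)
Lemma heart_kernel_cokernel (X Y : T) (f : hom X Y) :
  in_heart t X -> in_heart t Y ->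
  exists (K Q : T) (i : hom K X) (p : hom Y Q),
  [/\ in_heart t K /\ in_heart t Q,
      f ∘ i = 0 /\ (forall W, in_heart t W -> forall u : hom W X, f ∘ u = 0 ->
        exists! v, i ∘ v = u),
      p ∘ f = 0 /\ (forall W, in_heart t W -> forall u : hom Y W, u ∘ f = 0 ->
        exists! v, v ∘ p = u),
      is_zero K -> forall W (u : hom W Y), p ∘ u = 0 -> exists v, f ∘ v = u
    & is_zero Q -> forall W (u : hom X W), u ∘ i = 0 -> exists v, v ∘ f = u].
Proof.
move=> /in_heartP[X0 /Dge0_homP X1] /in_heartP[Y0 /Dge0_homP Y1].
have [Z [g [h d]]] := dist_cone f.
have [K [Q [a [c [e [K0 Q2 dK]]]]]] := trunc_triangle_shift Z.
have Z0 : tle0 t Z by apply: (tle0_ext (dist_rot1 d)) => //; apply: tle0_shift.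
have Q0 : tle0 t Q.
  by apply: (tle0_ext (dist_rot1 dK)) => //; apply/(tle0_iter_shift 2).
move: (Q2) => /Dge0_homP Q3.
(* Uniqueness: [a] and [h] cancel on the left against shifted maps from D^{<=0},
   and [c] and [g] cancel on the right against maps to D^{>=0}, because the
   neighbouring term of each triangle is orthogonal to such maps. *)
have aI W (u : hom (Σ W) (Σ K)) : tle0 t W -> a ∘ u = 0 -> u = 0.
  move=> W0 au; have [v ve] := shift_full u.
  apply/(shift_inj (T := T)).
  have [|w <-] := dist_shift_lift (u := fmap Σ u) dK.
    by rewrite -fmapM au fmap0.
  by rewrite (Q3 (Σ W) (tle0_shift W0) w) compm0 fmap0.
have hI W (u : hom (Σ W) Z) : tle0 t W -> h ∘ u = 0 -> u = 0.
  move=> W0 hu; have [v <-] := dist_lift (dist_rot1 d) hu.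
  by rewrite (Y1 W W0 v) compm0.
have cI W (u : hom Q W) : Dge t 0 W -> u ∘ c = 0 -> u = 0.
  move=> /Dge0_homP W1 uc; have [v <-] := dist_colift (dist_rot1 dK) uc.
  by rewrite (W1 _ (tle0_shift K0) v) comp0m.
have gI W (u : hom Z W) : Dge t 0 W -> u ∘ g = 0 -> u = 0.
  move=> /Dge0_homP W1 ug; have [v <-] := dist_colift (dist_rot1 d) ug.
  by rewrite (W1 _ X0 v) comp0m.
(* [Σ K -> Z -> Σ X] cancels on the left against maps from D^{<=-2}, and these
   become zero in [Σ X]. *)
have K1 : Dge t 0 K.
  apply/Dge0_homP => A A0 u; apply: (shift_inj (T := T)); rewrite fmap0.
  apply: aI; first exact: tle0_shift.
  apply: hI; first exact: tle0_shift.
  have [v <-] := shift_full (h ∘ (a ∘ fmap Σ u)).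
  by rewrite (X1 A A0 v) fmap0.
(* The kernel map is the desuspension of [Σ K -> Z -> Σ X]. *)
have [i ie] := shift_full (h ∘ a).
have hf : fmap Σ f ∘ h = 0.
  apply/oppr_inj; rewrite -compNm oppr0.
  exact: dist_comp0 (dist_rot1 (dist_rot1 d)).
exists K, Q, i, (c ∘ g); split.
- by split; apply/in_heartP.
- split.
    by apply: (shift_inj (T := T)); rewrite fmapM ie compmA hf comp0m fmap0.
  move=> W /in_heartP[W0 W1] u fu.
  have [|w hw] := dist_shift_lift (u := fmap Σ u) d; first by rewrite -fmapM fu fmap0.
  have [v' av'] := dist_lift dK (Q3 W W0 (c ∘ w)).
  have [v ve] := shift_full v'.
  exists v; split.
    by apply: (shift_inj (T := T)); rewrite fmapM ie ve -compmA av'.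
  move=> v2 iv2; apply/eqP; rewrite -subr_eq0; apply/eqP.
  apply: (shift_inj (T := T)); rewrite fmap0; apply: (aI W) => //.
  apply: (hI W) => //; rewrite compmA -ie -fmapM compmB iv2.
  suff -> : i ∘ v = u by rewrite subrr fmap0.
  by apply: (shift_inj (T := T)); rewrite fmapM ie ve -compmA av'.
- split; first by rewrite -compmA (dist_comp0 d) compm0.
  move=> W /in_heartP[_ W1] u uf.
  have [w wg] := dist_colift d uf.
  have [v vc] := dist_colift dK (proj1 (Dge0_homP W) W1 _ K0 (w ∘ a)).
  exists v; split; first by rewrite compmA vc.
  move=> v2 v2p; apply/eqP; rewrite -subr_eq0; apply/eqP.
  apply: cI => //; apply: gI => //.
  by rewrite -compmA compDm compNm compmA vc wg v2p subrr.
- move=> /shift_zero KZ W u; rewrite -compmA => cgu.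
  apply: (dist_lift d); have [v <-] := dist_lift dK cgu.
  by rewrite (proj2 (KZ W) v) compm0.
move=> QZ W u ui.
have [|v' e1] := dist_colift (dist_rot1 (dist_rot1 d)) (u := fmap Σ u).
  have [|w <-] := dist_colift dK (u := fmap Σ u ∘ h).
    by rewrite -compmA -ie -fmapM ui fmap0.
  by rewrite (proj1 (QZ _) w) comp0m.
have [v ve] := shift_full v'; rewrite -ve compmN -fmapM in e1.
exists (- v); apply: (shift_inj (T := T)); rewrite compNm -e1.
exact: linear_funN (@fmap_lin _ _ _ Σ _ _) _.
Qed.

(** A monomorphism has zero kernel and an epimorphism zero cokernel, so the last
two clauses of [heart_kernel_cokernel] give the factorizations, which are unique
by cancellation. *)
Lemma heart_abelian : abelian_cat (heart t).
Proof.
split; first exact: heart_additive.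
- move=> [X hX] [Y hY] f.
  have [K [_ [i [_ [[hK _] [fi iU] _ _ _]]]]] := heart_kernel_cokernel f hX hY.
  by exists (exist _ K hK), i; split=> // -[W hW]; apply: iU.
- move=> [X hX] [Y hY] f.
  have [_ [Q [_ [p [[_ hQ] _ [pf pU] _ _]]]]] := heart_kernel_cokernel f hX hY.
  by exists (exist _ Q hQ), p; split=> // -[W hW]; apply: pU.
- move=> [X hX] [Y hY] f fm.
  have [K [Q [i [p [[hK hQ] [fi iU] [pf _] mU _]]]]] :=
    heart_kernel_cokernel f hX hY.
  have i0 : i = 0.
    by apply: (fm (exist _ K hK) i 0); rewrite /= fi compm0.
  have K0 : is_zero K.
    apply/is_zeroP; have [v [_ vU]] := iU K hK 0 (compm0 _ _).
    by rewrite -(vU (idm K)) ?(vU 0) // ?compm0 ?compm1.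
  exists (exist _ Q hQ), p; split=> // -[W hW] u pu.
  have [v fv] := mU K0 W u pu; exists v; split=> // v' fv'.
  by apply: (fm (exist _ W hW)); apply: etrans fv (esym fv').
move=> [X hX] [Y hY] f fe.
have [K [Q [i [p [[hK hQ] [fi _] [pf pU] _ eU]]]]] :=
  heart_kernel_cokernel f hX hY.
have p0 : p = 0.
  by apply: (fe (exist _ Q hQ) p 0); rewrite /= pf comp0m.
have Q0 : is_zero Q.
  apply/is_zeroP; have [v [_ vU]] := pU Q hQ 0 (comp0m _ _).
  by rewrite -(vU (idm Q)) ?(vU 0) // ?comp0m ?comp1m.
exists (exist _ K hK), i; split=> // -[W hW] u ui.
have [v fv] := eU Q0 W u ui; exists v; split=> // v' fv'.
by apply: (fe (exist _ W hW)); apply: etrans fv (esym fv').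
Qed.

End HeartAbelian.

(** * Duality and the t-structure *)

Section HeartDuals.
Variables (k : fieldType) (T : monTriCat k) (t : tstructure T).
Hypothesis tm : monoidal_tstructure t.
Hypothesis dev0 : dev t 0.
Local Notation Σ := (shift T).
Local Notation one := (munit T).

Lemma hom_to_unit0 (A : T) : tle0 t A -> forall f : hom (Σ A) one, f = 0.
Proof. by apply: (proj1 (Dge0_homP _ _) (proj2 (unit_in_heart tm dev0))). Qed.

Lemma hom_from_unit0 (B : T) : tge1 t B -> forall f : hom one B, f = 0.
Proof. by apply: tle0_tge1; apply: unit_tle0 tm dev0. Qed.

Lemma tle0_tens (X Y : T) : tle0 t X -> tle0 t Y -> tle0 t (X ⊗[T] Y).
Proof.
by move=> X0 Y0; apply/Dle0P; apply: (proj1 dev0); apply/Dle0P.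
Qed.

(** [D^{>=1}] is the desuspension of [D^{>=0}], and the tensor product commutes
with shifts. *)
Lemma tge1_tensl (X Y : T) : tge1 t X -> Dge t 0 Y -> tge1 t (X ⊗[T] Y).
Proof.
move=> X1 Y0; apply/Dge0_shift/Dge0P.
apply: tge1_strict (fmap_isomorphic _ (shiftl_isomorphic X Y)) _.
by apply/Dge0P/(proj2 dev0) => //; apply/Dge0_shift.
Qed.

Lemma tge1_tensr (X Y : T) : Dge t 0 X -> tge1 t Y -> tge1 t (X ⊗[T] Y).
Proof.
move=> X0 Y1; apply/Dge0_shift/Dge0P.
apply: tge1_strict (fmap_isomorphic _ (shiftr_isomorphic X Y)) _.
by apply/Dge0P/(proj2 dev0) => //; apply/Dge0_shift.
Qed.

(** Through the adjunction a map [Σ A -> Y] corresponds to a map from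
[Σ A ⊗ X], an object of [D^{<=-1}], to the unit. *)
Lemma left_dual_le (X Y : T) : Dle t 0 X -> left_dual T X Y -> Dge t 0 Y.
Proof.
move=> /Dle0P X0 [ev [coev zz]]; apply/Dge0_homP => A A0 f.
apply: (zigzag_ev_l (mt_bilinear T) zz).
apply: (hom_iso_source0 (shiftl_isomorphic A X)).
exact/hom_to_unit0/tle0_tens.
Qed.

(** Through the adjunction a map [Y -> B] corresponds to a map from the unit to
[X ⊗ B], an object of [D^{>=1}]. *)
Lemma left_dual_ge (X Y : T) : Dge t 0 X -> left_dual T X Y -> Dle t 0 Y.
Proof.
move=> X0 [ev [coev zz]]; apply/Dle0P/tle0_orth => B B1 f.
apply: (zigzag_coev_r (mt_bilinear T) zz).
exact/hom_from_unit0/tge1_tensr.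
Qed.

(** For right duals the dual tensors from the other side. *)
Lemma right_dual_le (X Y : T) : Dle t 0 X -> right_dual T X Y -> Dge t 0 Y.
Proof.
move=> /Dle0P X0 [ev [coev zz]]; apply/Dge0_homP => A A0 f.
apply: (zigzag_ev_r (mt_bilinear T) zz).
apply: (hom_iso_source0 (shiftr_isomorphic X A)).
exact/hom_to_unit0/tle0_tens.
Qed.

Lemma right_dual_ge (X Y : T) : Dge t 0 X -> right_dual T X Y -> Dle t 0 Y.
Proof.
move=> X0 [ev [coev zz]]; apply/Dle0P/tle0_orth => B B1 f.
apply: (zigzag_coev_l (mt_bilinear T) zz).
exact/hom_from_unit0/tge1_tensl.
Qed.

Lemma heart_left_duals : has_left_duals T ->
  has_left_duals (heart_monoidal tm dev0).
Proof.
move=> D [X hX]; have [Y dY] := D X.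
have hY : in_heart t Y.
  by case: hX => X0 X1; split; [apply: left_dual_ge dY|apply: left_dual_le dY].
have [ev [coev zz]] := dY; exists (exist _ Y hY).
do 2!eexists; exact: (zigzag_full_sub (heart_tens dev0)
  (H0_unit_in_heart tm dev0) (unit_to_H0_iso tm dev0)
  (X := exist _ X hX) (Y := exist _ Y hY) zz).
Qed.

Lemma heart_right_duals : has_right_duals T ->
  has_right_duals (heart_monoidal tm dev0).
Proof.
move=> D [X hX]; have [Y dY] := D X.
have hY : in_heart t Y.
  by case: hX => X0 X1; split; [apply: right_dual_ge dY|apply: right_dual_le dY].
have [ev [coev zz]] := dY; exists (exist _ Y hY).
do 2!eexists; exact: (zigzag_full_sub (heart_tens dev0)
  (H0_unit_in_heart tm dev0) (unit_to_H0_iso tm dev0)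
  (X := exist _ Y hY) (Y := exist _ X hX) zz).
Qed.

Lemma heart_tensor_category : rigid T -> End_iso_base one ->
  tensor_category (heart_monoidal tm dev0).
Proof.
move=> [lD rD] E; split; first exact: heart_abelian.
- by split; [apply: heart_left_duals|apply: heart_right_duals].
- exact: (bilinear_full_sub (mt_bilinear T) (heart_tens dev0)
    (H0_unit_in_heart tm dev0) (unit_to_H0_iso tm dev0)).
apply: (@End_iso_base_isomorphic k T one (H0 t one)) E.
by exists (unit_to_H0 tm dev0); apply: unit_to_H0_iso.
Qed.

End HeartDuals.

Theorem corollary2p26 (k : closedFieldType) (T : monTriCat k)
    (T_neq0 : nonzero_cat T) (t : tstructure T)
    (tm : monoidal_tstructure t) (dev0 : dev t 0)
    (t_red : tensor_reduced (heart_monoidal tm dev0)) :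
  (has_left_duals T ->
     (forall X, left_duals_of T (Dle t 0) X -> Dge t 0 X) /\
     (forall X, left_duals_of T (Dge t 0) X -> Dle t 0 X) /\
     has_left_duals (heart_monoidal tm dev0)) /\
  (has_right_duals T ->
     (forall X, right_duals_of T (Dle t 0) X -> Dge t 0 X) /\
     (forall X, right_duals_of T (Dge t 0) X -> Dle t 0 X) /\
     has_right_duals (heart_monoidal tm dev0)) /\
  (rigid T -> End_iso_base (munit T) ->
     tensor_category (heart_monoidal tm dev0)).
Proof.
split; [|split].
- move=> D; split; [|split].
  + by move=> Y [X X0]; apply: left_dual_le.
  + by move=> Y [X X0]; apply: left_dual_ge.
  + exact: heart_left_duals.
- move=> D; split; [|split].
  + by move=> Y [X X0]; apply: right_dual_le.
  + by move=> Y [X X0]; apply: right_dual_ge.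
  + exact: heart_right_duals.
- exact: heart_tensor_category.
Qed.
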